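(* Fix an integer $n\ge2$. The following are degenerations between the Jordan nets $B^{(1)}_{n/2}$ (for $n$ even) and $B^{(2)}_{k,\ell_1,\ell_2}$ in $\mathbb{S}^n$: (a) $B^{(1)}_{n/2}\to B^{(2)}_{k,0,n/2}$ for $1\leq k\leq n/4$, if $2\mid n$; (b) $B^{(2)}_{k,\ell_1,\ell_2}\to B^{(2)}_{k-1,\ell_1,\ell_2}$ for $k>1$. Moreover, they generate all degenerations among these nets: if $\mathcal{L},\mathcal{L}'\subseteq\mathbb{S}^n$ are nets of the form $B^{(1)}_{n/2}$ or $B^{(2)}_{k,\ell_1,\ell_2}$ and $\mathcal{L}$ degenerates to $\mathcal{L}'$, then $\mathcal{L}\to\mathcal{L}'$ is a (possibly empty) composition of degenerations from (a) and (b).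
   Context: $\mathbb{S}^n$ is the space of complex symmetric $n\times n$ matrices. The nets (subspaces of $\mathbb{S}^n$ of dimension $3$) are $$B^{(1)}_{n/2}:=\begin{pmatrix}x{\bf 1}_{n/2}&z{\bf 1}_{n/2}\\ z{\bf 1}_{n/2}&y{\bf 1}_{n/2}\end{pmatrix}\quad(n\text{ even}),$$ $$B^{(2)}_{k,\ell_1,\ell_2}:=\operatorname{Diag}\left(\begin{pmatrix}x{\bf J}_{\ell_2}&z\operatorname{Diag}({\bf 1}_k,{\bf 0}_{\ell_2-k})\\ z\operatorname{Diag}({\bf 1}_k,{\bf 0}_{\ell_2-k})&y{\bf J}_{\ell_2}\end{pmatrix},y{\bf 1}_{\ell_1}\right),\qquad \ell_1\ge0,\ \ell_2\ge2,\ 1\le k\le\ell_2/2,\ \ell_1+2\ell_2=n.$$ Here a matrix whose entries are linear forms in indeterminates $x,y,z$ denotes the linear space of all matrices obtained by substituting complex numbers; ${\bf 1}_k$, ${\bf 0}_k$ are the $k\times k$ identity and zero matrices, ${\bf J}_k$ is the $k\times k$ matrix with $1$'s on the anti-diagonal and $0$'s elsewhere, and $\operatorname{Diag}$ denotes block-diagonal matrices (blocks of size $0$ omitted). They are Jordan nets, i.e. $3$-dimensional subspaces containing an invertible $U$ and closed under $X\bullet_UY=\frac12(XU^{-1}Y+YU^{-1}X)$. Degeneration: let $\mathcal{L},\mathcal{L}'\subseteq\mathbb{S}^n$ be such spaces of the same dimension $m$ with bases $X_1,\dots,X_m$ and $X_1',\dots,X_m'$. Then $\mathcal{L}$ degenerates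 to $\mathcal{L}'$, written $\mathcal{L}\to\mathcal{L}'$, if there exist $P\in\mathrm{GL}_n(\mathbb{C}[t^{\pm1}])$ and $Q\in\mathrm{GL}_m(\mathbb{C}[t^{\pm1}])$ such that the entries of $(Y_1,\dots,Y_m):=(PX_1P^\top,\dots,PX_mP^\top)Q$ are matrices with coefficients in $\mathbb{C}[t]$ and $X_i'=\lim_{t\to0}Y_i$ for all $i$. (Equivalently, $\mathcal{L}'$ lies in the closure of the orbit of $\mathcal{L}$ under the congruence action $g\cdot\mathcal{L}=g\mathcal{L}g^\top$ of $\mathrm{GL}_n(\mathbb{C})$.) *)

(* Defs.v *)
From HB Require Import structures.
From mathcomp Require Import all_boot all_order all_algebra.
From mathcomp Require Import complex.
From mathcomp Require Import boolp classical_sets reals topology normedtype.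
From Stdlib Require Import Relation_Operators.

Set Implicit Arguments.
Unset Strict Implicit.
Unset Printing Implicit Defensive.

Import GRing.Theory Num.Theory.
Import numFieldNormedType.Exports.
Local Open Scope ring_scope.

Section Nets.
Variable K : numFieldType.

Definition antidiag_mx n : 'M[K]_n := \matrix_(i, j) (j == rev_ord i)%:R.

(* [conform_mx 0] only casts the block sizes to [n]: it is the identity up to
   the equality of dimensions when that equality holds, and it returns the junk
   value 0 otherwise ([n] odd in [B1_mx], [l2 + l2 + l1 <> n] in [B2_mx]). *)
Definition B1_mx n (x y z : K) : 'M[K]_n :=
  conform_mx 0 (block_mx x%:M z%:M z%:M y%:M : 'M_(n./2 + n./2)).

(* [pid_mx k : 'M_l2] is Diag(1_k, 0_(l2 - k)) when k <= l2. *)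
Definition B2_mx n k l1 l2 (x y z : K) : 'M[K]_n :=
  conform_mx 0
    (block_mx
       (block_mx (x *: antidiag_mx l2) (z *: pid_mx k)
                 (z *: pid_mx k)       (y *: antidiag_mx l2)) 0
       0 (y%:M : 'M_l1)
     : 'M_(l2 + l2 + l1)).

Definition B2_params n k l1 l2 : Prop :=
  [/\ (2 <= l2)%N, (1 <= k)%N, (k.*2 <= l2)%N & (l1 + l2.*2)%N = n].

(* The space of all values of a matrix of linear forms in x, y, z;
   see [memv_netB1] and [memv_netB2]. *)
Definition net_of n (M : K -> K -> K -> 'M[K]_n) : {vspace 'M[K]_n} :=
  <<[:: M 1 0 0; M 0 1 0; M 0 0 1]%R>>%VS.

Definition netB1 n := net_of (@B1_mx n).
Definition netB2 n k l1 l2 := net_of (@B2_mx n k l1 l2).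

Lemma memv_net_of n (M : K -> K -> K -> 'M[K]_n) :
  (forall x y z, M x y z = x *: M 1 0 0 + y *: M 0 1 0 + z *: M 0 0 1) ->
  forall A, A \in net_of M <-> exists x y z, A = M x y z.
Proof.
move=> linM A; split=> [|[x [y [z ->]]]].
  rewrite /net_of !span_cons span_nil addv0.
  case/memv_addP=> _ /vlineP[x ->] [_ /memv_addP[_ /vlineP[y ->]] [_ /vlineP[z ->] ->] ->].
  by exists x, y, z; rewrite [RHS]linM addrA.
rewrite linM; apply: rpredD; first apply: rpredD; apply: rpredZ;
  by apply: memv_span; rewrite !inE eqxx ?orbT.
Qed.

Lemma conform_mx0_linear m n (A B C D : 'M[K]_m) (x y z : K) :
  D = x *: A + y *: B + z *: C ->
  conform_mx (0 : 'M[K]_n) D =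
    x *: conform_mx (0 : 'M_n) A + y *: conform_mx (0 : 'M_n) B
    + z *: conform_mx (0 : 'M_n) C.
Proof.
move=> ->; have [e|ne] := eqVneq m n; last first.
  by rewrite !nonconform_mx ?ne // !scaler0 !addr0.
by case: n / e; rewrite !conform_mx_id.
Qed.

Lemma memv_netB1 n A : A \in netB1 n <-> exists x y z, A = B1_mx n x y z.
Proof.
apply: memv_net_of => x y z; rewrite /B1_mx.
apply: (@conform_mx0_linear (n./2 + n./2)).
rewrite !scale_block_mx !add_block_mx !scale_scalar_mx.
by rewrite !mulr1 !mulr0 !raddf0 !(addr0, add0r).
Qed.

Lemma memv_netB2 n k l1 l2 A :
  A \in netB2 n k l1 l2 <-> exists x y z, A = B2_mx n k l1 l2 x y z.
Proof.
apply: memv_net_of => x y z; rewrite /B2_mx.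
apply: (@conform_mx0_linear (l2 + l2 + l1)).
rewrite !scale_block_mx !add_block_mx !scale_scalar_mx !scalerA !scaler0.
by rewrite !mulr1 !mulr0 !scale0r ?raddf0 !(addr0, add0r).
Qed.

Inductive is_net n : {vspace 'M[K]_n} -> Prop :=
| IsNetB1 : ~~ odd n -> is_net (netB1 n)
| IsNetB2 k l1 l2 : B2_params n k l1 l2 -> is_net (netB2 n k l1 l2).

End Nets.

Section Degeneration.
Variable K : numFieldType.

(* The Laurent polynomial ring K[t, t^-1] is represented as a subring of the
   fraction field of {poly K}. *)
Local Notation frac := {fraction {poly K}}.

Definition is_laurent (f : frac) : Prop :=
  exists (p : {poly K}) (d : nat), f = tofrac p / tofrac 'X^d.

Definition GL_laurent n (A : 'M[frac]_n) : Prop :=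
  [/\ forall i j, is_laurent (A i j),
      A \in unitmx &
      forall i j, is_laurent (invmx A i j)].

Definition frac_const (c : K) : frac := tofrac c%:P.

Local Open Scope classical_set_scope.

Definition degenerates n (L L' : {vspace 'M[K]_n}) : Prop :=
  exists (m : nat) (X X' : m.-tuple 'M[K]_n)
         (P : 'M[frac]_n) (Q : 'M[frac]_m) (Y : 'I_m -> 'M[{poly K}]_n),
  [/\ basis_of L X, basis_of L' X', GL_laurent P, GL_laurent Q &
      forall j : 'I_m,
        map_mx (@tofrac _) (Y j) =
          \sum_(i < m) Q i j *: (P *m map_mx frac_const (tnth X i) *m P^T)
        /\ (forall a b, (Y j a b).[s] @[s --> (0 : K)^'] --> tnth X' j a b)].

End Degeneration.

Inductive generating_step (K : numFieldType) n :
  {vspace 'M[K]_n} -> {vspace 'M[K]_n} -> Prop :=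
| StepB1B2 k : ~~ odd n -> (1 <= k)%N -> (4 * k <= n)%N ->
    generating_step (netB1 K n) (netB2 K n k 0 n./2)
| StepB2B2 k l1 l2 : B2_params n k l1 l2 -> (1 < k)%N ->
    generating_step (netB2 K n k l1 l2) (netB2 K n k.-1 l1 l2).

(* Main.v *)
Require Import Defs.
From mathcomp Require Import all_boot all_order all_algebra complex reals.
From mathcomp Require Import generic_quotient fraction zify ring.
From mathcomp Require Import boolp classical_sets topology normedtype.
From Stdlib Require Import Relation_Operators.

(** Write B1 and B2(k, l1, l2) for the two kinds of nets, K for the complex
    numbers and F for the field K(t) of rational functions.

    The degenerations (a) and (b) are explicit.  Let J be the antidiagonal
    matrix and let T be a diagonal matrix of powers of t whose entries at i and
    at its mirror image are mutually inverse, so that T J T = J.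
    - (b): acting by T on the first l2 coordinates fixes both blocks x J and
      y J, and turns z Diag(1_k, 0) into z T Diag(1_k, 0).  With T equal to t at
      position k and to 1/t at its mirror image, the k-th entry becomes t z and
      disappears in the limit ([degenerates_B2_B2]).
    - (a): over a field with a square root of -1 the matrix J has a symmetric
      square root S = a 1 + b J.  Acting on B1 by Diag(S, T J S) gives the
      blocks x J, y J and z T.  With T equal to 1/t at the first k positions,
      t at their mirror images and 1 in between, t T tends to Diag(1_k, 0), so
      it suffices to rescale the third basis vector by t
      ([degenerates_B1_B2]).

    For the converse only the generic fibre of a degeneration matters: there is
    a polynomial family of matrices W(a), linear in a, with value L'(a) at
    t = 0, and W(a) = P L(q a) P^T over F for some P and some linear map q
    ([specializes]).  Two invariants decide everything.
    - Determinants.  On B2 the determinant is x^l2 y^(l1+l2), on B1 it is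
      (x y - z^2)^(n/2).  After clearing denominators and dividing by a power
      of t, the forms x(q a), y(q a) (or the quadratic form) get a nonzero
      value at t = 0 ([primitive_frac_vector]).  As det W(a) has a value at
      t = 0 too, the determinant of L' is, up to a constant, the same product
      of powers of these limit forms ([proportional_at_0]).  For B2 to B2,
      comparing factors gives equal l1 and l2; for B2 to B1, a linear form
      would divide x y - z^2; for B1 to B2, the quadratic form must tend to a
      multiple of x y, so l1 = 0.
    - Rank.  For B2 to B2 the point x = y = 0 of the generic fibre is the cross
      product of the two linear forms; by the previous item its limit is a
      nonzero multiple of the point x = y = 0 of L'.  These points have ranks
      2k and 2k', and rank can only drop under specialization ([rank_at_0]),
      so k' <= k. *)

Set Implicit Arguments.
Unset Strict Implicit.
Unset Printing Implicit Defensive.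

Import GRing.Theory Num.Theory.
Import numFieldNormedType.Exports.
Local Open Scope ring_scope.

(** * Specialization from rational functions to the point t = 0 *)

Lemma fracP (D : idomainType) (f : {fraction D}) :
  exists p d, d != 0 /\ f = tofrac p / tofrac d.
Proof.
rewrite -[f]reprK; move: (repr f) => r.
exists (frac r).1, (frac r).2; split; first exact: denom_ratioP.
rewrite -[RHS]/(FracField.mul (tofrac (frac r).1)
                              (FracField.inv (tofrac (frac r).2))).
rewrite !piE; apply/eqmodP => /=.
rewrite FracField.equivfE /FracField.invf /FracField.mulf.
have nz := denom_ratioP r.
rewrite !(numden_Ratio, oner_neq0, mul1r, mulr1, nz) //.
by rewrite mulrC.
Qed.

Lemma horner_cvg0 (K : numFieldType) (p : {poly K}) :
  ((p.[s] @[s --> (0 : K)^']) --> p.[0])%classic.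
Proof.
suff cts : ((p.[s] @[s --> (0 : K)]) --> p.[0])%classic.
  by apply: cvg_within_filter; exact: cts.
elim/poly_ind: p => [|p c ih].
  under eq_fun do rewrite horner0.
  rewrite horner0.
  refine (@cvg_cst (K : topologicalType) 0 K (nbhs (0 : K)) _).
under eq_fun do rewrite hornerMXaddC.
rewrite hornerMXaddC.
refine (@cvgD K K^o K (nbhs (0 : K)) _ (fun s => p.[s] * s) (fun=> c)
  (p.[0] * 0) c _ _).
  refine (@cvgM K K (nbhs (0 : K)) _ (fun s => p.[s]) id p.[0] 0 ih _).
  refine (@cvg_id _ _).
refine (@cvg_cst (K : topologicalType) c K (nbhs (0 : K)) _).
Qed.

Lemma cvg0_horner (K : numFieldType) (p : {poly K}) (c : K) :
  ((p.[s] @[s --> (0 : K)^']) --> c)%classic -> p.[0] = c.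
Proof.
move=> pc.
by apply: (@cvg_unique _ (@norm_hausdorff _ K) _ _ _ _ (@horner_cvg0 _ p) pc).
Qed.

Lemma div_extend (F : fieldType) (x y z : F) :
  z != 0 -> x / y = (y * z)^-1 * (x * z).
Proof. by move=> z0; rewrite invfM (mulrC x z) mulrA divfK // mulrC. Qed.

(** The field of rational functions is kept abstract, as a field F of fractions
    of the polynomials through iota, so that conversion never unfolds the
    arithmetic of representatives in the quotient type. *)
Section Primitive.
Variables (K : numFieldType) (F : fieldType).
Variable iota : {rmorphism {poly K} -> F}.
Hypothesis iota_inj : injective iota.
Hypothesis iota_frac : forall f, exists p d, d != 0 /\ f = iota p / iota d.

Let iota_eq0 p : (iota p == 0) = (p == 0).
Proof. by rewrite -(inj_eq iota_inj) rmorph0. Qed.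


(** A vector of polynomials vanishing at 0 is divisible by X; dividing lowers
    the size of a fixed nonzero entry, so this stops. *)
Lemma primitive_poly_vector (I : finType) (p : I -> {poly K}) i :
  p i != 0 ->
  exists (d : nat) (w : I -> {poly K}),
    (forall i, p i = 'X^d * w i) /\ exists i, (w i).[0] != 0.
Proof.
move: {2}(size (p i)) (leqnn (size (p i))) => m.
elim: m p => [|m IH] p; first by rewrite size_poly_leq0 => /eqP->; rewrite eqxx.
move=> sp pi0.
have [/existsP ex0|all0] := boolP [exists j, (p j).[0] != 0].
  exists 0%N, p; split=> [k|]; last by [].
  by rewrite expr0 mul1r.
have /fin_all_exists[q qE] j : exists q, p j = 'X * q.
  move: all0; rewrite negb_exists => /forallP/(_ j); rewrite negbK => /factor_theorem[q ->].
  by exists q; rewrite subr0 mulrC.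
have qi0 : q i != 0 by move: pi0; rewrite qE mulf_eq0 negb_or => /andP[].
have [|//|d [w [qw w0]]] := IH q.
  by move: sp; rewrite qE mulrC size_mulX.
exists d.+1, w; split=> // k.
by rewrite qE qw exprS mulrA.
Qed.

(** This replaces the limit of a point of projective space over F: the value of
    w at 0 is the limit point of the line spanned by u. *)
Lemma primitive_frac_vector (I : finType) (u : I -> F) i :
  u i != 0 ->
  exists (c : F) (w : I -> {poly K}),
    (forall i, u i = c * iota (w i)) /\ exists i, (w i).[0] != 0.
Proof.
move=> ui0.
have /fin_all_exists2[d d0 /fin_all_exists[p pE]] j :
    exists2 d : {poly K}, d != 0 & exists p, u j = iota p / iota d.
  by have [p [d [d0 ->]]] := iota_frac (u j); exists d => //; exists p.
pose e := \prod_j d j.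
have e0 : e != 0 by apply/prodf_neq0 => j _.
pose q j := p j * \prod_(k | k != j) d k.
have uE j : u j = (iota e)^-1 * iota (q j).
  rewrite pE /e /q (bigD1 j) //= !rmorphM; apply: div_extend.
  by rewrite iota_eq0; apply/prodf_neq0 => k _.
have qi0 : q i != 0.
  by apply: contraNneq ui0 => qi; rewrite uE qi rmorph0 mulr0.
have [k [w [qw w0]]] := primitive_poly_vector qi0.
exists ((iota e)^-1 * iota 'X^k), w; split=> // j.
by rewrite uE qw rmorphM mulrA.
Qed.

(** The unknown scalar c has no pole at 0 and its value there can be read off
    at b: eliminating c leaves the polynomial identity D a * G b = D b * G a. *)
Lemma proportional_at_0 (A : Type) (D G : A -> {poly K}) (c : F) (b : A) :
  (forall a, iota (D a) = c * iota (G a)) -> (G b).[0] != 0 ->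
  forall a, (D a).[0] = (D b).[0] / (G b).[0] * (G a).[0].
Proof.
move=> DG Gb a.
have : D a * G b = D b * G a.
  by apply/eqP; rewrite -(inj_eq iota_inj) !rmorphM !DG mulrAC.
move/(congr1 (horner^~ 0)); rewrite !hornerM => DGab.
by apply: (mulIf Gb); rewrite DGab mulrAC divfK.
Qed.

(** Constant matrices M and N that make M A N the identity of size r at t = 0
    make its determinant nonzero over F. *)
Lemma rank_at_0 m n (A : 'M[{poly K}]_(m, n)) :
  (\rank (map_mx (horner_eval 0%R) A) <= \rank (map_mx iota A))%N.
Proof.
set A0 := map_mx _ A; set r := \rank A0.
have [M [N MAN]] : exists M N, M *m A0 *m N = 1%:M :> 'M_r.
  exists (pinvmx (col_base A0)), (pinvmx (row_base A0)).
  set M := pinvmx _; set N := pinvmx _.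
  apply: etrans (congr1 (fun B => M *m B *m N) (esym (mulmx_base A0))) _.
  rewrite mulmxA mulVpmx ?col_base_full // mul1mx.
  by rewrite mulmxVp ?row_base_free.
pose B := map_mx polyC M *m A *m map_mx polyC N.
have const (p q : nat) (C : 'M_(p, q)) :
    map_mx (horner_eval (0 : K)) (map_mx polyC C) = C.
  by apply/matrixP=> i j; rewrite !mxE /horner_eval hornerC.
have detB : \det B != 0.
  apply: contra_eq_neq (det1 K r) => detB.
  rewrite -MAN -[M]const -[N]const -!map_mxM det_map_mx -/B detB.
  by rewrite rmorph0 eq_sym oner_neq0.
have fB : map_mx iota B \in unitmx.
  by rewrite unitmxE det_map_mx unitfE iota_eq0.
rewrite -(mxrank_unit fB) !map_mxM.
by apply: leq_trans (mxrankM_maxl _ _) _; apply: mxrankM_maxr.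
Qed.
End Primitive.

(** * Determinants and ranks in the two nets *)

Section Forms.
Variable R : comNzRingType.

(** The matrices that define the nets, with entries in any commutative ring R:
    they are also needed over F, which carries no norm. *)
Definition anti n : 'M[R]_n := \matrix_(i, j) (j == rev_ord i)%:R.

Definition B1_form n (x y z : R) : 'M[R]_n :=
  conform_mx 0 (block_mx x%:M z%:M z%:M y%:M : 'M_(n./2 + n./2)).

Definition B2_core k l (x y z : R) : 'M[R]_(l + l) :=
  block_mx (x *: anti l) (z *: pid_mx k) (z *: pid_mx k) (y *: anti l).

Definition B2_form n k l1 l2 (x y z : R) : 'M[R]_n :=
  conform_mx 0 (block_mx (B2_core k l2 x y z) 0 0 (y%:M : 'M_l1)).

Lemma conform_mx_linear m n (A B C D : 'M[R]_m) (x y z : R) :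
  D = x *: A + y *: B + z *: C ->
  conform_mx (0 : 'M[R]_n) D =
    x *: conform_mx 0 A + y *: conform_mx 0 B + z *: conform_mx 0 C.
Proof.
move=> ->; have [e|ne] := eqVneq m n; last first.
  by rewrite !nonconform_mx ?ne // !scaler0 !addr0.
by case: n / e; rewrite !conform_mx_id.
Qed.

Definition linear3 n (M : R -> R -> R -> 'M[R]_n) := forall x y z,
  M x y z = x *: M 1 0 0 + y *: M 0 1 0 + z *: M 0 0 1.

Lemma B1_form_linear n : linear3 (B1_form n).
Proof.
move=> x y z; apply: conform_mx_linear.
rewrite !scale_block_mx !add_block_mx !scale_scalar_mx.
by rewrite !mulr1 !mulr0 !raddf0 !(addr0, add0r).
Qed.

Lemma B2_form_linear n k l1 l2 : linear3 (B2_form n k l1 l2).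
Proof.
move=> x y z; apply: conform_mx_linear; rewrite /B2_core.
rewrite !scale_block_mx !add_block_mx !scale_scalar_mx !scalerA !scaler0.
by rewrite !mulr1 !mulr0 !scale0r ?raddf0 !(addr0, add0r).
Qed.

Lemma tr_anti n : (anti n)^T = anti n.
Proof.
by apply/matrixP=> i j; rewrite !mxE eq_sym -(inj_eq rev_ord_inj) rev_ordK eq_sym.
Qed.

Lemma mul_anti_mx m n (A : 'M_(n, m)) i j : (anti n *m A) i j = A (rev_ord i) j.
Proof.
rewrite mxE (bigD1 (rev_ord i)) //= mxE eqxx mul1r big1 ?addr0 // => k /negPf ne.
by rewrite mxE ne mul0r.
Qed.

Lemma mul_mx_anti m n (A : 'M_(m, n)) i j : (A *m anti n) i j = A i (rev_ord j).
Proof.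
have -> : A *m anti n = (anti n *m A^T)^T by rewrite trmx_mul tr_anti trmxK.
by rewrite mxE mul_anti_mx mxE.
Qed.

Lemma anti_mxK n : anti n *m anti n = 1%:M.
Proof.
by apply/matrixP=> i j; rewrite mul_anti_mx !mxE rev_ordK eq_sym.
Qed.

(** As k <= l / 2, the first k positions are disjoint from their mirror
    images. *)
Lemma pid_anti_pid k l : (k.*2 <= l)%N ->
  pid_mx k *m anti l *m pid_mx k = 0 :> 'M_l.
Proof.
move=> kl; apply/matrixP=> i j; rewrite mxE big1 ?mxE // => p _.
rewrite mul_mx_anti !mxE; case: eqP => [/= ip|]; rewrite ?mul0r //=.
case: (ltnP i k) => ik; rewrite ?mul0r //=.
case: (ltnP p k) => pk; rewrite ?andbF ?mulr0 //=.
by have := ltn_ord p; lia.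
Qed.

End Forms.

Section MapForms.
Variables (R S : comNzRingType) (f : {rmorphism R -> S}).

Lemma map_anti n : map_mx f (anti R n) = anti S n.
Proof. by apply/matrixP=> i j; rewrite !mxE rmorph_nat. Qed.

Lemma map_B1_form n x y z :
  map_mx f (B1_form n x y z) = B1_form n (f x) (f y) (f z).
Proof. by rewrite map_conform_mx map_mx0 map_block_mx !map_scalar_mx. Qed.

Lemma map_B2_core k l x y z :
  map_mx f (B2_core k l x y z) = B2_core k l (f x) (f y) (f z).
Proof. by rewrite map_block_mx !map_mxZ map_anti map_pid_mx. Qed.

Lemma map_B2_form n k l1 l2 x y z :
  map_mx f (B2_form n k l1 l2 x y z) = B2_form n k l1 l2 (f x) (f y) (f z).
Proof.
rewrite map_conform_mx !map_mx0 map_block_mx map_B2_core.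
by rewrite !map_mx0 map_scalar_mx.
Qed.

End MapForms.

Section Invariants.
Variable F : fieldType.

Lemma det_scalar_block h (x y z : F) :
  \det (block_mx x%:M z%:M z%:M y%:M : 'M_(h + h)) = (x * y - z ^+ 2) ^+ h.
Proof.
have [->|y0] := eqVneq y 0.
  (* A rotation by a quarter turn makes the matrix block triangular. *)
  pose W : 'M[F]_(h + h) := block_mx 0 1%:M (- 1%:M) 0.
  have detW : \det W = 1.
    have -> : W = block_mx 1%:M 1%:M 0 1%:M *m block_mx 1%:M 0 (- 1%:M) 1%:M
                  *m block_mx 1%:M 1%:M 0 1%:M.
      rewrite !mulmx_block !(mul1mx, mulmx1, mulmx0, mul0mx, addr0, add0r, subrr).
      by rewrite addNr.
    by rewrite !det_mulmx !det_ublock det_lblock !det1 !mulr1.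
  rewrite -[LHS]mulr1 -detW -det_mulmx mulmx_block.
  rewrite !(mulmxN, mulmx1, mulmx0, addr0, add0r) raddf0 oppr0 det_ublock.
  rewrite -scaleN1r scale_scalar_mx !det_scalar -exprMn.
  by rewrite mulr0 sub0r mulN1r mulNr expr2.
(* When y is invertible, column operations clear the lower left block. *)
pose V : 'M[F]_(h + h) := block_mx 1%:M 0 (- (z / y))%:M 1%:M.
have detV : \det V = 1 by rewrite det_lblock !det1 mulr1.
rewrite -[LHS]mulr1 -detV -det_mulmx mulmx_block.
rewrite !(mulmx1, mulmx0, add0r) -!scalar_mxM -!raddfD /=.
have -> : z + y * - (z / y) = 0 by rewrite mulrN mulrCA divff // mulr1 subrr.
rewrite raddf0 det_ublock !det_scalar -exprMn; congr (_ ^+ _).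
by rewrite mulrDl mulrN mulNr mulrA divfK // expr2.
Qed.

Lemma det_B1_form n (x y z : F) : ~~ odd n ->
  \det (B1_form n x y z) = (x * y - z ^+ 2) ^+ n./2.
Proof.
move=> /even_halfK nh; rewrite /B1_form; move: n./2 nh => h; rewrite -addnn => nh.
by case: n / nh; rewrite conform_mx_id det_scalar_block.
Qed.

(** The z-blocks do not contribute: for x invertible, the Schur complement of
    x J differs from y J by a multiple of D J D = 0, where D is the partial
    identity; for x = 0 one row is zero, because k < l. *)
Lemma det_B2_core k l (x y z : F) : (0 < l)%N -> (k.*2 <= l)%N ->
  \det (B2_core k l x y z) = x ^+ l * y ^+ l.
Proof.
case: l => // l _ kl; rewrite /B2_core.
have [->|x0] := eqVneq x 0.
  rewrite expr0n mul0r (expand_det_row _ (lshift l.+1 ord_max)) big1 // => j _.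
  rewrite (_ : block_mx _ _ _ _ _ j = 0) ?mul0r //.
  case: (split_ordP j) => {}j ->; rewrite (block_mxEul, block_mxEur) !mxE ?mul0r //.
  by rewrite (_ : (l < k)%N = false) ?andbF ?mulr0 //; lia.
set J := anti F _; set D := pid_mx k.
have -> : block_mx (x *: J) (z *: D) (z *: D) (y *: J) =
    block_mx 1%:M 0 ((z / x) *: (D *m J)) 1%:M
    *m block_mx (x *: J) (z *: D) 0 (y *: J).
  rewrite mulmx_block !(mul1mx, mul0mx, mulmx0, addr0, add0r).
  rewrite -!scalemxAl -!scalemxAr pid_anti_pid // !scaler0 add0r.
  by rewrite -mulmxA anti_mxK mulmx1 scalerA divfK.
rewrite det_mulmx det_lblock det_ublock !det1 !mul1r !detZ.
by rewrite mulrACA -det_mulmx anti_mxK det1 mulr1.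
Qed.

Lemma det_B2_form n k l1 l2 (x y z : F) : B2_params n k l1 l2 ->
  \det (B2_form n k l1 l2 x y z) = x ^+ l2 * y ^+ (l1 + l2).
Proof.
case=> l2_ge2 k_gt0 kl; rewrite -addnn addnC => nE.
case: n / nE; rewrite /B2_form conform_mx_id det_ublock det_B2_core ?(ltnW l2_ge2) //.
by rewrite det_scalar -mulrA -exprD addnC.
Qed.

Lemma rank_B2_form001 n k l1 l2 : B2_params n k l1 l2 ->
  \rank (B2_form n k l1 l2 0 0 1 : 'M[F]_n) = k.*2.
Proof.
case=> l2_ge2 k_gt0 kl; rewrite -addnn addnC => nE.
case: n / nE; rewrite /B2_form conform_mx_id rank_diag_block_mx raddf0 mxrank0 addn0.
rewrite /B2_core !scale0r scale1r.
pose W : 'M[F]_(l2 + l2) := block_mx 0 1%:M 1%:M 0.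
have WK : W *m W = 1%:M.
  by rewrite mulmx_block !(mul1mx, mul0mx, addr0, add0r) -scalar_mx_block.
have fW : row_free W by rewrite row_free_unit; case: (mulmx1_unit WK).
rewrite -(mxrankMfree _ fW) mulmx_block !(mulmx1, mulmx0, addr0, add0r).
by rewrite rank_diag_block_mx rank_pid_mx ?addnn //; lia.
Qed.

Lemma rank_B2_form00 n k l1 l2 z : B2_params n k l1 l2 ->
  (\rank (B2_form n k l1 l2 0 0 z : 'M[F]_n) <= k.*2)%N.
Proof.
move=> par; rewrite B2_form_linear !scale0r !add0r.
by rewrite -(rank_B2_form001 par) mxrank_scale.
Qed.

End Invariants.

(** * Limits of linear and quadratic forms *)

Section LinearForms.
Variable K : numFieldType.

Lemma linear_forms_avoid (u0 u1 u2 v0 v1 v2 : K) :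
  [|| u0 != 0, u1 != 0 | u2 != 0] -> [|| v0 != 0, v1 != 0 | v2 != 0] ->
  exists x y z, u0 * x + u1 * y + u2 * z != 0 /\ v0 * x + v1 * y + v2 * z != 0.
Proof.
have nz (a0 a1 a2 : K) : [|| a0 != 0, a1 != 0 | a2 != 0] ->
    exists x y z, a0 * x + a1 * y + a2 * z != 0.
  by case/or3P=> a_neq0; [exists 1, 0, 0|exists 0, 1, 0|exists 0, 0, 1];
     rewrite !(mulr0, mulr1, addr0, add0r).
move=> /nz[x [y [z ux]]] /nz[x' [y' [z' vx]]].
have [vx0|] := eqVneq (v0 * x + v1 * y + v2 * z) 0; last by exists x, y, z.
have [ux0|] := eqVneq (u0 * x' + u1 * y' + u2 * z') 0; last by exists x', y', z'.
exists (x + x'), (y + y'), (z + z'); split.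
  by rewrite (_ : _ + _ = u0 * x + u1 * y + u2 * z) // -[RHS]addr0 -ux0; ring.
by rewrite (_ : _ + _ = v0 * x' + v1 * y' + v2 * z') // -[RHS]addr0 -vx0; ring.
Qed.

Lemma quadratic_neq0 (a b c : K) : [|| a != 0, b != 0 | c != 0] ->
  exists x y, a * x ^+ 2 + b * (x * y) + c * y ^+ 2 != 0.
Proof.
have [c0|] := eqVneq c 0; last first.
  move=> c0 _; exists 0, 1.
  by rewrite !(expr0n, mul0r, mulr0, add0r, expr1n, mulr1).
have [a0|] := eqVneq a 0; last first.
  move=> a0 _; exists 1, 0.
  by rewrite !(expr0n, mul0r, mulr0, addr0, expr1n, mulr1).
rewrite /= orbF => b0; exists 1, 1.
by rewrite a0 c0 !mul0r add0r addr0 !mulr1.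
Qed.

(** A plane contained in the union of the planes x = 0 and y = 0 is one of
    them. *)
Lemma form_in_coordinate_cross (a b c : K) : [|| a != 0, b != 0 | c != 0] ->
  (forall x y z, a * x + b * y + c * z = 0 -> x * y = 0) ->
  c = 0 /\ ((a != 0 /\ b = 0) \/ (a = 0 /\ b != 0)).
Proof.
move=> abc vanish; have c0 : c = 0.
  by have /eqP := vanish c c (- (a + b)) ltac:(ring); rewrite mulf_eq0 orbb => /eqP.
split=> //; move: abc; rewrite c0 eqxx orbF.
have /eqP := vanish b (- a) 0 ltac:(ring).
rewrite mulrN oppr_eq0 mulf_eq0 => /orP[] /eqP->; rewrite eqxx ?orbF /=.
  by left.
by right.
Qed.

Lemma form_not_in_conic (a b c : K) : [|| a != 0, b != 0 | c != 0] ->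
  ~ (forall x y z, a * x + b * y + c * z = 0 -> x * y - z ^+ 2 = 0).
Proof.
move=> abc vanish.
have a0 : a = 0.
  have /eqP := vanish c 0 (- a) ltac:(ring).
  by rewrite mulr0 sub0r oppr_eq0 sqrf_eq0 oppr_eq0 => /eqP.
have b0 : b = 0.
  have /eqP := vanish 0 c (- b) ltac:(ring).
  by rewrite mul0r sub0r oppr_eq0 sqrf_eq0 oppr_eq0 => /eqP.
have /eqP := vanish 1 1 0 ltac:(rewrite a0 b0; ring).
by rewrite mulr1 expr0n subr0 oner_eq0.
Qed.

Lemma exp2_inj : injective (fun m => 2%:R ^+ m : K).
Proof.
move=> a b /eqP; rewrite -!natrX eqr_nat => /eqP ab.
by apply/eqP; rewrite -(@eqn_exp2l 2) // ab.
Qed.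

End LinearForms.

Section Specialization.
Variables (K : numFieldType) (F : fieldType) (iota : {rmorphism {poly K} -> F}).
Hypothesis iota_inj : injective iota.
Hypothesis iota_frac : forall f, exists p d, d != 0 /\ f = iota p / iota d.

Lemma primitive_triple (u0 u1 u2 : F) : [|| u0 != 0, u1 != 0 | u2 != 0] ->
  exists c (w0 w1 w2 : {poly K}),
    [/\ u0 = c * iota w0, u1 = c * iota w1, u2 = c * iota w2 &
        [|| w0.[0] != 0, w1.[0] != 0 | w2.[0] != 0]].
Proof.
move=> u_neq0; pose u (i : 'I_3) := nth 0 [:: u0; u1; u2] i.
have [i ui] : exists i, u i != 0.
  by case/or3P: u_neq0 => ?; [exists (@Ordinal 3 0 isT)
    |exists (@Ordinal 3 1 isT)|exists (@Ordinal 3 2 isT)].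
have [c [w [uE [j wj]]]] := primitive_frac_vector iota_inj iota_frac ui.
exists c, (w (@Ordinal 3 0 isT)), (w (@Ordinal 3 1 isT)),
  (w (@Ordinal 3 2 isT)).
split; rewrite -?uE //.
by case: j wj => [[|[|[|//]]] lt3] wj; apply/or3P;
  [apply: Or31|apply: Or32|apply: Or33];
  move: wj; congr (_.[_] != _); congr w; apply: val_inj.
Qed.

(** The generic fibre of a degeneration from the net NF to the net NK, with a
    polynomial family through the limit.  No invertibility is imposed on P and
    on the 3 x 3 matrix with rows u, v, w: as soon as some matrix in NK is
    invertible, P is invertible and the forms occurring in the determinant of
    NF do not vanish identically. *)
Definition specializes n (NF : F -> F -> F -> 'M[F]_n)
    (NK : K -> K -> K -> 'M[K]_n) :=
  exists (P : 'M[F]_n) (u0 u1 u2 v0 v1 v2 w0 w1 w2 : F)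
    (W : {poly K} -> {poly K} -> {poly K} -> 'M[{poly K}]_n),
    (forall x y z, map_mx iota (W x y z) =
      P *m NF (u0 * iota x + u1 * iota y + u2 * iota z)
              (v0 * iota x + v1 * iota y + v2 * iota z)
              (w0 * iota x + w1 * iota y + w2 * iota z) *m P^T)
    /\ (forall x y z,
      map_mx (horner_eval 0) (W x y z) = NK x.[0] y.[0] z.[0]).

Let iota_eq0 p : (iota p == 0) = (p == 0).
Proof. by rewrite -(inj_eq iota_inj) rmorph0. Qed.

(** Here u and v are the limits of the two linear forms x and y of the net.
    The cross product of the forms spans their common zero, where the generic
    matrix has rank at most 2k; the last clause is the limit of this. *)
Lemma limit_of_B2 n k l1 l2 (NK : K -> K -> K -> 'M[K]_n) :
  B2_params n k l1 l2 -> specializes (B2_form n k l1 l2) NK ->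
  (exists x y z, \det (NK x y z) != 0) ->
  exists c u0 u1 u2 v0 v1 v2 : K,
    [/\ [|| u0 != 0, u1 != 0 | u2 != 0], [|| v0 != 0, v1 != 0 | v2 != 0],
        forall x y z, \det (NK x y z) =
          c * ((u0 * x + u1 * y + u2 * z) ^+ l2
               * (v0 * x + v1 * y + v2 * z) ^+ (l1 + l2)) &
        (\rank (NK (u1 * v2 - u2 * v1)%R (u2 * v0 - u0 * v2)%R
                   (u0 * v1 - u1 * v0)%R) <= k.*2)%N].
Proof.
move=> par [P [u0 [u1 [u2 [v0 [v1 [v2 [w0 [w1 [w2 [W [WF WK]]]]]]]]]]]].
move=> [x1 [y1 [z1 det1]]].
have detWF x y z : iota (\det (W x y z)) = \det P ^+ 2 *
    ((u0 * iota x + u1 * iota y + u2 * iota z) ^+ l2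
     * (v0 * iota x + v1 * iota y + v2 * iota z) ^+ (l1 + l2)).
  by rewrite -det_map_mx WF !det_mulmx det_tr (det_B2_form _ _ _ par) mulrAC -expr2.
have detWK x y z : (\det (W x y z)).[0] = \det (NK x.[0] y.[0] z.[0]).
  by rewrite -WK det_map_mx.
have l2_gt0 : (0 < l2)%N by case: par => /ltnW.
have detW1 : iota (\det (W x1%:P y1%:P z1%:P)) != 0.
  rewrite iota_eq0; apply: contraNneq det1 => W0.
  by have := detWK x1%:P y1%:P z1%:P; rewrite !hornerC W0 horner0 => <-.
have u_neq0 : [|| u0 != 0, u1 != 0 | u2 != 0].
  apply: contraNT detW1; rewrite !negb_or !negbK => /and3P[/eqP z0 /eqP z1' /eqP z2].
  by rewrite detWF z0 z1' z2 !mul0r !addr0 expr0n eqn0Ngt l2_gt0 mul0r mulr0.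
have v_neq0 : [|| v0 != 0, v1 != 0 | v2 != 0].
  apply: contraNT detW1; rewrite !negb_or !negbK => /and3P[/eqP z0 /eqP z1' /eqP z2].
  rewrite detWF z0 z1' z2 !mul0r !addr0 expr0n addn_eq0 (eqn0Ngt l2) l2_gt0.
  by rewrite andbF !mulr0.
have [cu [p0 [p1 [p2 [u0E u1E u2E p_neq0]]]]] := primitive_triple u_neq0.
have [cv [q0 [q1 [q2 [v0E v1E v2E q_neq0]]]]] := primitive_triple v_neq0.
have UE x y z : u0 * iota x + u1 * iota y + u2 * iota z =
    cu * iota (p0 * x + p1 * y + p2 * z).
  by rewrite !rmorphD !rmorphM u0E u1E u2E; ring.
have VE x y z : v0 * iota x + v1 * iota y + v2 * iota z =
    cv * iota (q0 * x + q1 * y + q2 * z).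
  by rewrite !rmorphD !rmorphM v0E v1E v2E; ring.
have [b0 [b1 [b2 [pb qb]]]] := linear_forms_avoid p_neq0 q_neq0.
pose D (a : K * K * K) := \det (W a.1.1%:P a.1.2%:P a.2%:P).
pose G (a : K * K * K) :=
  (p0 * a.1.1%:P + p1 * a.1.2%:P + p2 * a.2%:P) ^+ l2
  * (q0 * a.1.1%:P + q1 * a.1.2%:P + q2 * a.2%:P) ^+ (l1 + l2).
have G0 a : (G a).[0] =
    (p0.[0] * a.1.1 + p1.[0] * a.1.2 + p2.[0] * a.2) ^+ l2
    * (q0.[0] * a.1.1 + q1.[0] * a.1.2 + q2.[0] * a.2) ^+ (l1 + l2).
  by rewrite !hornerE.
have DG a : iota (D a) = \det P ^+ 2 * cu ^+ l2 * cv ^+ (l1 + l2) * iota (G a).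
  by rewrite detWF UE VE rmorphM !rmorphXn !exprMn; ring.
have Gb : (G (b0, b1, b2)).[0] != 0 by rewrite G0 mulf_neq0 // expf_neq0.
exists ((D (b0, b1, b2)).[0] / (G (b0, b1, b2)).[0]).
exists p0.[0], p1.[0], p2.[0], q0.[0], q1.[0], q2.[0]; split=> // [x y z|].
  have := proportional_at_0 iota_inj DG Gb (x, y, z).
  by rewrite (G0 (x, y, z)) {1}/D detWK !hornerC.
pose r0 := p1 * q2 - p2 * q1; pose r1 := p2 * q0 - p0 * q2.
pose r2 := p0 * q1 - p1 * q0.
have := rank_at_0 iota_inj (W r0 r1 r2); rewrite WK WF UE VE.
rewrite (_ : p0 * r0 + p1 * r1 + p2 * r2 = 0); last by rewrite /r0 /r1 /r2; ring.
rewrite (_ : q0 * r0 + q1 * r1 + q2 * r2 = 0); last by rewrite /r0 /r1 /r2; ring.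
rewrite rmorph0 !mulr0 !hornerE => /leq_trans-> //.
apply: leq_trans (mxrankM_maxl _ _) (leq_trans (mxrankM_maxr _ _) _).
exact: rank_B2_form00.
Qed.

Lemma B2_specializes_B2 n k l1 l2 k' l1' l2' :
  B2_params n k l1 l2 -> B2_params n k' l1' l2' ->
  specializes (B2_form n k l1 l2) (B2_form n k' l1' l2') ->
  [/\ l1' = l1, l2' = l2 & (k' <= k)%N].
Proof.
move=> par par' spec.
have detK (x y z : K) := det_B2_form x y z par'.
have [|c [u0 [u1 [u2 [v0 [v1 [v2 [u_neq0 v_neq0 detE rk]]]]]]]] :=
  limit_of_B2 par spec.
  by exists 1, 1, 0; rewrite detK !expr1n mulr1 oner_neq0.
have [l2_ge2 k_gt0 kl nE] := par; have [l2'_ge2 k'_gt0 kl' nE'] := par'.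
have detuv x y z : x ^+ l2' * y ^+ (l1' + l2') =
    c * ((u0 * x + u1 * y + u2 * z) ^+ l2
         * (v0 * x + v1 * y + v2 * z) ^+ (l1 + l2)) by rewrite -(detK x y z).
have xy0 x y : x ^+ l2' * y ^+ (l1' + l2') = 0 -> x * y = 0 :> K.
  move/eqP; rewrite mulf_eq0 !expf_eq0.
  by case/orP=> /andP[_ /eqP->]; rewrite ?mul0r ?mulr0.
have [u2_0 uxy] : u2 = 0 /\ ((u0 != 0 /\ u1 = 0) \/ (u0 = 0 /\ u1 != 0)).
  apply: form_in_coordinate_cross => // x y z u_0; apply: xy0.
  by rewrite (detuv x y z) u_0 expr0n eqn0Ngt (ltnW l2_ge2) mul0r mulr0.
have [v2_0 vxy] : v2 = 0 /\ ((v0 != 0 /\ v1 = 0) \/ (v0 = 0 /\ v1 != 0)).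
  apply: form_in_coordinate_cross => // x y z v_0; apply: xy0.
  by rewrite (detuv x y z) v_0 expr0n addn_eq0 (eqn0Ngt l2) (ltnW l2_ge2) andbF !mulr0.
(* The values at four points determine which coordinate u and v are multiples
   of, and then the exponents, as powers of 2. *)
have c_neq0 : c != 0.
  apply: contra_eq_neq (detuv 1 1 0) => ->.
  by rewrite !expr1n mulr1 mul0r oner_neq0.
have det11 := detuv 1 1 0; have det21 := detuv 2%:R 1 0.
have det10 := detuv 1 0 0; have det01 := detuv 0 1 0.
rewrite !(mulr0, mulr1, addr0, expr1n, mul1r) in det11 det21 det10 det01.
rewrite !(addr0, add0r) in det10 det01.
have e_gt0 (m : nat) : (m > 0)%N -> 0 ^+ m = 0 :> K by rewrite expr0n eqn0Ngt => ->.
rewrite e_gt0 in det10; last by lia.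
rewrite e_gt0 in det01; last by lia.
have {}det10 : u0 = 0 \/ v0 = 0.
  move/esym/eqP: det10; rewrite !mulf_eq0 (negPf c_neq0) !expf_eq0 /=.
  by case/orP => /andP[_ /eqP ?]; [left|right].
have {}det01 : u1 = 0 \/ v1 = 0.
  move/esym/eqP: det01; rewrite !mulf_eq0 (negPf c_neq0) !expf_eq0 /=.
  by case/orP => /andP[_ /eqP ?]; [left|right].
have [l2E r_neq0] : l2' = l2 /\ u0 * v1 - u1 * v0 != 0.
  case: uxy => -[u0P u1P]; case: vxy => -[v0P v1P].
  - by case: det10 => /eqP; rewrite (negPf u0P, negPf v0P).
  - split; last by rewrite v0P mulr0 subr0 mulf_neq0.
    rewrite !u1P !v0P !mul0r !addr0 !add0r exprMn in det11 det21.
    apply: (@exp2_inj K); rewrite det21.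
    rewrite -[RHS]mulr1 [X in _ = _ * X]det11 [RHS]mulrCA.
    by congr (_ * _); rewrite -mulrA mulrCA.
  - split; last by rewrite u0P mul0r sub0r oppr_eq0 mulf_neq0.
    (* The two forms are exchanged; together with l1 + 2 l2 = n on both sides
       this forces l1 = l1' = 0. *)
    have : l2' = (l1 + l2)%N; last by lia.
    rewrite !u0P !v1P !mul0r !addr0 !add0r exprMn in det11 det21.
    apply: (@exp2_inj K); rewrite det21.
    rewrite -[RHS]mulr1 [X in _ = _ * X]det11 [RHS]mulrCA.
    by congr (_ * _); rewrite mulrA mulrC.
  - by case: det01 => /eqP; rewrite (negPf u1P, negPf v1P).
split=> //; first by lia.
move: rk; rewrite u2_0 v2_0 !(mulr0, mul0r) subrr B2_form_linear !scale0r !add0r.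
by rewrite mxrank_scale_nz // rank_B2_form001 //; lia.
Qed.

Lemma B2_not_specializes_B1 n k l1 l2 :
  B2_params n k l1 l2 -> ~~ odd n ->
  ~ specializes (B2_form n k l1 l2) (B1_form n).
Proof.
move=> par n_even spec; have detK (x y z : K) := det_B1_form x y z n_even.
have [|c [u0 [u1 [u2 [v0 [v1 [v2 [u_neq0 v_neq0 detE _]]]]]]]] :=
  limit_of_B2 par spec.
  by exists 1, 1, 0; rewrite detK mulr1 expr0n subr0 expr1n oner_neq0.
apply: (form_not_in_conic u_neq0) => x y z u_0.
have := detE x y z; rewrite detK u_0 expr0n eqn0Ngt.
have [/ltnW-> _ _ _] := par; rewrite mul0r mulr0 => /eqP.
by rewrite expf_eq0 => /andP[_ /eqP].
Qed.

Lemma B1_specializes_B2 n k' l1' l2' :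
  ~~ odd n -> B2_params n k' l1' l2' ->
  specializes (B1_form n) (B2_form n k' l1' l2') -> l1' = 0%N /\ l2' = n./2.
Proof.
move=> n_even par' [P [u0 [u1 [u2 [v0 [v1 [v2 [w0 [w1 [w2 [W [WF WK]]]]]]]]]]]].
have [l2'_ge2 k'_gt0 kl' nE'] := par'.
have [h_gt0 l2'_gt0] : (0 < n./2)%N /\ (0 < l2')%N by lia.
have l12'_gt0 : (0 < l1' + l2')%N by rewrite addn_gt0 l2'_gt0 orbT.
suff l2E : l2' = n./2 by split=> //; lia.
(* The restriction to the pencil z = 0 of the limit net suffices; a, b and d are
   the coefficients there of the quadratic form pulled back from the
   degenerating net. *)
pose a := u0 * v0 - w0 ^+ 2; pose b := u0 * v1 + u1 * v0 - (w0 * w1) *+ 2.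
pose d := u1 * v1 - w1 ^+ 2.
have detWF x y : iota (\det (W x y 0)) = \det P ^+ 2 *
    (a * iota x ^+ 2 + b * (iota x * iota y) + d * iota y ^+ 2) ^+ n./2.
  rewrite -det_map_mx WF !det_mulmx det_tr det_B1_form // mulrAC -expr2 rmorph0.
  by congr (_ * _ ^+ _); rewrite /a /b /d; ring.
have detWK x y : (\det (W x y 0)).[0] = x.[0] ^+ l2' * y.[0] ^+ (l1' + l2').
  have <- := det_B2_form x.[0] y.[0] (0 : {poly K}).[0] par'.
  by rewrite -WK det_map_mx.
have abd_neq0 : [|| a != 0, b != 0 | d != 0].
  have: iota (\det (W 1 1 0)) != 0.
    rewrite iota_eq0; apply: contra_eq_neq (detWK 1 1) => ->.
    by rewrite horner0 hornerC !expr1n mulr1 eq_sym oner_neq0.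
  apply: contraNT; rewrite !negb_or !negbK => /and3P[/eqP a0 /eqP b0 /eqP d0].
  by rewrite detWF a0 b0 d0 !mul0r !addr0 expr0n eqn0Ngt h_gt0 mulr0.
have [c [p0 [p1 [p2 [aE bE dE p_neq0]]]]] := primitive_triple abd_neq0.
have [b0 [b1 pb]] := quadratic_neq0 p_neq0.
pose D (s : K * K) := \det (W s.1%:P s.2%:P 0).
pose G (s : K * K) :=
  (p0 * s.1%:P ^+ 2 + p1 * (s.1%:P * s.2%:P) + p2 * s.2%:P ^+ 2) ^+ n./2.
have G0 s : (G s).[0] =
    (p0.[0] * s.1 ^+ 2 + p1.[0] * (s.1 * s.2) + p2.[0] * s.2 ^+ 2) ^+ n./2.
  by rewrite !hornerE.
have DG s : iota (D s) = \det P ^+ 2 * c ^+ n./2 * iota (G s).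
  rewrite detWF -mulrA rmorphXn -exprMn; congr (_ * _ ^+ _).
  by rewrite !expr2 !rmorphD !rmorphM aE bE dE; ring.
have Gb : (G (b0, b1)).[0] != 0 by rewrite G0 expf_neq0.
have := proportional_at_0 iota_inj DG Gb; set C := _ / _ => DE.
have detE x y : x ^+ l2' * y ^+ (l1' + l2') = C *
    (p0.[0] * x ^+ 2 + p1.[0] * (x * y) + p2.[0] * y ^+ 2) ^+ n./2.
  by have := DE (x, y); rewrite (G0 (x, y)) {1}/D detWK !hornerC.
have C_neq0 : C != 0.
  apply: contra_eq_neq (detE 1 1) => ->.
  by rewrite !expr1n mulr1 mul0r oner_neq0.
have e_gt0 (m : nat) : (m > 0)%N -> 0 ^+ m = 0 :> K by rewrite expr0n eqn0Ngt => ->.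
have p0_0 : p0.[0] = 0.
  have /esym/eqP := detE 1 0; rewrite !e_gt0 //.
  rewrite !mulr0 !addr0 expr1n mulr1 mulf_eq0 (negPf C_neq0) expf_eq0 /=.
  by case/andP=> _ /eqP.
have p2_0 : p2.[0] = 0.
  have /esym/eqP := detE 0 1; rewrite !e_gt0 //.
  rewrite !mul0r !mulr0 !add0r expr1n mulr1 mulf_eq0 (negPf C_neq0) expf_eq0 /=.
  by case/andP=> _ /eqP.
have det11 := detE 1 1; have det21 := detE 2%:R 1.
rewrite !p0_0 !p2_0 !expr1n !mulr1 !mul0r !addr0 !add0r in det11 det21.
by apply: (@exp2_inj K); rewrite det21 exprMn mulrA -det11 mul1r.
Qed.

End Specialization.

(** * The possible degenerations *)

Section LinearCombinations.
Variables (K : numFieldType) (F : fieldType) (iota : {rmorphism {poly K} -> F}).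
Variables (n : nat) (M M' : K -> K -> K -> 'M[K]_n) (NF : F -> F -> F -> 'M[F]_n).
Hypothesis M_linear : linear3 M.
Hypothesis M'_linear : linear3 M'.
Hypothesis NF_linear : linear3 NF.
Hypothesis NF_M : forall x y z,
  map_mx (iota \o polyC) (M x y z) = NF (iota x%:P) (iota y%:P) (iota z%:P).

(** The matrices over F of the form P N P^T with N in the net NF form a linear
    subspace containing every Y j; hence every element of the limit net is the
    value at 0 of a polynomial matrix in this subspace, and lifting M' 1 0 0,
    M' 0 1 0 and M' 0 0 1 gives the family W. *)
Lemma specializes_of_basis m (X X' : m.-tuple 'M[K]_n) (P : 'M[F]_n) (Q : 'M[F]_m)
    (Y : 'I_m -> 'M[{poly K}]_n) :
  basis_of (net_of M) X -> basis_of (net_of M') X' ->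
  (forall j, map_mx iota (Y j) =
     \sum_(i < m) Q i j *: (P *m map_mx (iota \o polyC) (tnth X i) *m P^T)) ->
  (forall j, map_mx (horner_eval 0) (Y j) = tnth X' j) ->
  specializes iota NF M'.
Proof.
move=> basX basX' YX YX'.
pose good A := exists u v w, A = P *m NF u v w *m P^T.
have good0 : good 0.
  by exists 0, 0, 0; rewrite NF_linear !scale0r !addr0 mulmx0 mul0mx.
have goodD A B : good A -> good B -> good (A + B).
  move=> [u [v [w ->]]] [u' [v' [w' ->]]]; exists (u + u'), (v + v'), (w + w').
  rewrite -mulmxDl -mulmxDr; congr (_ *m _ *m _).
  rewrite (NF_linear (u + u')) (NF_linear u) (NF_linear u') !scalerDl.
  by rewrite addrACA; congr (_ + _); rewrite addrACA.
have goodZ c A : good A -> good (c *: A).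
  move=> [u [v [w ->]]]; exists (c * u), (c * v), (c * w).
  rewrite scalemxAl scalemxAr (NF_linear u) (NF_linear (c * u)).
  by rewrite !scalerDr !scalerA.
have goodS (I : finType) (G : I -> 'M[F]_n) :
    (forall i, good (G i)) -> good (\sum_i G i).
  by move=> goodG; apply: big_ind => // i _; exact: goodG.
have goodY j : good (map_mx iota (Y j)).
  rewrite YX; apply: goodS => i; apply: goodZ.
  have /(memv_net_of M_linear)[x [y [z ->]]] : tnth X i \in net_of M.
    by rewrite -(span_basis basX) memv_span ?mem_tnth.
  by rewrite NF_M; do 3!eexists.
have lift x y z : exists2 A, good (map_mx iota A) &
    map_mx (horner_eval 0) A = M' x y z.
  have /coord_span-> : M' x y z \in <<X'>>%VS.
    by rewrite (span_basis basX'); apply/(memv_net_of M'_linear); do 3!eexists.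
  exists (\sum_i (coord X' i (M' x y z))%:P *: Y i).
    by rewrite map_mx_sum; apply: goodS => i; rewrite map_mxZ; apply: goodZ.
  rewrite map_mx_sum; apply: eq_bigr => i _.
  by rewrite map_mxZ YX' (tnth_nth 0) /= /horner_eval hornerC.
have [A [u0 [v0 [w0 AE]]] A0] := lift 1 0 0.
have [B [u1 [v1 [w1 BE]]] B0] := lift 0 1 0.
have [C [u2 [v2 [w2 CE]]] C0] := lift 0 0 1.
exists P, u0, u1, u2, v0, v1, v2, w0, w1, w2,
  (fun x y z => x *: A + y *: B + z *: C).
split=> x y z; last first.
  by rewrite !map_mxD !map_mxZ A0 B0 C0 [RHS]M'_linear.
rewrite !map_mxD !map_mxZ AE BE CE.
have congrZ c (N : 'M[F]_n) : c *: (P *m N *m P^T) = P *m (c *: N) *m P^T.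
  by rewrite -scalemxAr -scalemxAl.
rewrite !congrZ -!mulmxDl -!mulmxDr.
congr (_ *m _ *m _); rewrite (NF_linear u0) (NF_linear u1) (NF_linear u2).
rewrite (NF_linear (_ + _)); apply/matrixP=> i j; rewrite !mxE; ring.
Qed.
End LinearCombinations.

Section Instances.
Variable K : numFieldType.
Local Notation frac := {fraction {poly K}}.

Let fc : {rmorphism K -> frac} := @tofrac {poly K} \o @polyC K.
Let tofrac_morph : {rmorphism {poly K} -> frac} := @tofrac {poly K}.

Lemma tofrac_inj : injective tofrac_morph.
Proof. by move=> p q /eqP; rewrite tofrac_eq => /eqP. Qed.

Lemma degenerates_specializes n
    (M M' : forall R : comNzRingType, R -> R -> R -> 'M[R]_n) :
  (forall R, linear3 (M R)) -> (forall R, linear3 (M' R)) ->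
  (forall (R S : comNzRingType) (f : {rmorphism R -> S}) x y z,
     map_mx f (M R x y z) = M S (f x) (f y) (f z)) ->
  degenerates (net_of (M K)) (net_of (M' K)) ->
  specializes tofrac_morph (M frac) (M' K).
Proof.
move=> Mlin M'lin Mmap [m [X [X' [P [Q [Y [bX bX' _ _ XY]]]]]]].
apply: (@specializes_of_basis K frac tofrac_morph n (M K) (M' K) (M frac)
  (Mlin _) (M'lin _) (Mlin _) _ m X X' P Q Y) => //.
- exact: (Mmap K frac fc).
- by move=> j; case: (XY j).
- move=> j; apply/matrixP=> a b; rewrite mxE; case: (XY j) => _ /(_ a b) lim.
  exact: cvg0_horner lim.
Qed.

Lemma degenerations_among_nets n (L L' : {vspace 'M[K]_n}) :
  is_net L -> is_net L' -> degenerates L L' ->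
  clos_refl_trans _ (@generating_step K n) L L'.
Proof.
have B1lin (R : comNzRingType) := @B1_form_linear R n.
have B2lin k l1 l2 (R : comNzRingType) := @B2_form_linear R n k l1 l2.
have B1map (R S : comNzRingType) (f : {rmorphism R -> S}) :=
  @map_B1_form R S f n.
have B2map k l1 l2 (R S : comNzRingType) (f : {rmorphism R -> S}) :=
  @map_B2_form R S f n k l1 l2.
case=> [n_even|k l1 l2 par] [n_even'|k' l1' l2' par'] deg.
- exact: rt_refl.
- have := degenerates_specializes B1lin (B2lin k' l1' l2') B1map deg.
  case/(B1_specializes_B2 tofrac_inj (@fracP _) n_even par') => l1_0 l2E.
  rewrite l1_0 l2E; apply: rt_step; apply: StepB1B2 => //; first by case: par'.
  by case: par'; lia.
- have := degenerates_specializes (B2lin k l1 l2) B1lin (B2map k l1 l2) deg.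
  by case/(B2_not_specializes_B1 tofrac_inj (@fracP _) par n_even').
- have := degenerates_specializes (B2lin k l1 l2) (B2lin k' l1' l2')
    (B2map k l1 l2) deg.
  case/(B2_specializes_B2 tofrac_inj (@fracP _) par par') => l1E l2E k'k.
  rewrite {deg} l1E l2E in par' *.
  elim: k k'k par => [|k IH].
    by rewrite leqn0 => /eqP-> _; exact: rt_refl.
  rewrite leq_eqVlt => /orP[/eqP-> _|k'k par]; first exact: rt_refl.
  have par1 : B2_params n k l1 l2.
    by case: par => ? ? ? ?; case: par' => ? ? ? ?; split=> //; lia.
  apply: rt_trans (IH _ par1) => //.
  by apply: rt_step; apply: (StepB2B2 _ par); case: par' => ? ? ? ?; lia.
Qed.
End Instances.

(** * Orthogonal congruences *)

Section Congruences.
Variables (R : comNzRingType) (l : nat).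
Local Notation J := (anti R l).

(** For a * b = 1 and s disjoint from its mirror image, a diagonal element of
    the orthogonal group of J. *)
Definition torus (s : pred 'I_l) (a b : R) : 'M[R]_l :=
  diag_mx (\row_i (if s i then a else if s (rev_ord i) then b else 1)).

Lemma tr_torus (s : pred 'I_l) a b : (torus s a b)^T = torus s a b.
Proof. exact: tr_diag_mx. Qed.

Lemma torus_anti (s : pred 'I_l) a b : a * b = 1 -> (forall i, s i -> ~~ s (rev_ord i)) ->
  torus s a b *m J *m torus s a b = J.
Proof.
move=> ab s_rev; apply/matrixP=> i j.
rewrite /torus mul_diag_mx mul_mx_diag !mxE.
have [->|] := eqVneq j (rev_ord i); last by rewrite mulr0 mul0r.
rewrite rev_ordK mulr1.
case si: (s i); first by rewrite (negPf (s_rev i si)).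
by case: (s (rev_ord i)); rewrite ?mulr1 // mulrC.
Qed.

Lemma torus_inv (s : pred 'I_l) a b : a * b = 1 -> (forall i, s i -> ~~ s (rev_ord i)) ->
  torus s a b *m (J *m torus s a b *m J) = 1%:M.
Proof. by move=> ab s_rev; rewrite !mulmxA torus_anti // anti_mxK. Qed.

Lemma congr_B2_core k (T : 'M[R]_l) x y z : T^T = T -> T *m J *m T = J ->
  block_mx T 0 0 1%:M *m B2_core k l x y z *m (block_mx T 0 0 1%:M)^T =
  block_mx (x *: J) (z *: (T *m pid_mx k)) (z *: (pid_mx k *m T)) (y *: J).
Proof.
move=> trT TJT; rewrite tr_block_mx !trmx0 trmx1 trT /B2_core !mulmx_block.
rewrite !(mul0mx, mulmx0, mul1mx, mulmx1, addr0, add0r).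
by rewrite -!scalemxAr -!scalemxAl TJT.
Qed.

Lemma congr_block_diag m (U A : 'M[R]_l) (B : 'M[R]_m) :
  block_mx U 0 0 1%:M *m block_mx A 0 0 B *m (block_mx U 0 0 1%:M)^T =
  block_mx (U *m A *m U^T) 0 0 B.
Proof.
rewrite tr_block_mx !trmx0 trmx1 !mulmx_block.
by rewrite !(mul0mx, mulmx0, mul1mx, mulmx1, addr0, add0r).
Qed.

Lemma block_diag_inv m (U V : 'M[R]_l) : U *m V = 1%:M ->
  block_mx U 0 0 1%:M *m block_mx V 0 0 1%:M = 1%:M :> 'M_(l + m).
Proof.
move=> UV; rewrite mulmx_block !(mul0mx, mulmx0, mul1mx, addr0, add0r) UV.
by rewrite -scalar_mx_block.
Qed.

(** As J is a symmetric involution, (a + b J)^2 = (a^2 + b^2) + 2 a b J. *)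
Definition sqrt_anti (a b : R) : 'M[R]_l := a%:M + b *: J.

Lemma tr_sqrt_anti a b : (sqrt_anti a b)^T = sqrt_anti a b.
Proof. by rewrite linearD linearZ /= tr_scalar_mx tr_anti. Qed.

Lemma sqrt_antiP a b : a ^+ 2 + b ^+ 2 = 0 -> (a * b) *+ 2 = 1 ->
  sqrt_anti a b *m sqrt_anti a b = J.
Proof.
move=> ab0 ab1; rewrite /sqrt_anti mulmxDl !mulmxDr -scalar_mxM mul_scalar_mx.
rewrite mul_mx_scalar -scalemxAl -scalemxAr anti_mxK !scalerA scalemx1.
transitivity ((a ^+ 2 + b ^+ 2)%:M + ((a * b) *+ 2) *: J).
  by apply/matrixP=> i j; rewrite !mxE; case: (i == j); case: (j == _); ring.
by rewrite ab0 ab1 raddf0 add0r scale1r.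
Qed.

(** The second block T J S of the congruence is chosen so that S (T J S)^T = T,
    given S S = J. *)
Lemma congr_scalar_block (S T : 'M[R]_l) x y z :
  S^T = S -> S *m S = J -> T^T = T -> T *m J *m T = J ->
  let P := block_mx S 0 0 (T *m J *m S) in
  P *m block_mx x%:M z%:M z%:M y%:M *m P^T =
  block_mx (x *: J) (z *: T) (z *: T) (y *: J).
Proof.
move=> trS SS trT TJT P; rewrite /P tr_block_mx !trmx0 trS !trmx_mul trS trT tr_anti.
rewrite !mulmx_block !(mul0mx, mulmx0, addr0, add0r).
rewrite !mul_mx_scalar -!scalemxAl.
have SSJT : S *m (S *m (J *m T)) = T by rewrite mulmxA SS mulmxA anti_mxK mul1mx.
have -> : T *m J *m S *m S = T by rewrite -mulmxA SS -mulmxA anti_mxK mulmx1.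
by rewrite SS SSJT -(mulmxA (T *m J) S) SSJT TJT.
Qed.

Lemma scalar_block_inv (S T : 'M[R]_l) : S *m S = J -> T *m J *m T = J ->
  block_mx S 0 0 (T *m J *m S) *m block_mx (S *m J) 0 0 (S *m (J *m T *m J))
    = 1%:M.
Proof.
move=> SS TJT; rewrite mulmx_block !(mul0mx, mulmx0, addr0, add0r).
rewrite mulmxA SS anti_mxK -(mulmxA (T *m J) S) (mulmxA S S) SS !mulmxA.
by rewrite -(mulmxA T J J) anti_mxK mulmx1 TJT anti_mxK -scalar_mx_block.
Qed.

End Congruences.

Section Independence.
Variable R : idomainType.

Lemma scale_anti_eq0 l (x : R) : (0 < l)%N -> x *: anti R l = 0 -> x = 0.
Proof.
case: l => // l _ /matrixP/(_ ord0 (rev_ord ord0)).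
by rewrite !mxE eqxx mulr1.
Qed.

Lemma B2_core_eq0 k l (x y z : R) : (0 < k <= l)%N ->
  B2_core k l x y z = 0 -> [/\ x = 0, y = 0 & z = 0].
Proof.
move=> /andP[k_gt0 kl] /eqP; rewrite block_mx_eq0.
case/and4P=> [/eqP xJ /eqP zD _ /eqP yJ].
have l_gt0 : (0 < l)%N by exact: leq_trans kl.
split; [exact: scale_anti_eq0 xJ | exact: scale_anti_eq0 yJ |].
case: l kl {xJ yJ l_gt0} zD => [|l] kl; first by lia.
by move/matrixP/(_ ord0 ord0); rewrite !mxE k_gt0 mulr1.
Qed.

Lemma scalar_block_eq0 h (x y z : R) : (0 < h)%N ->
  block_mx x%:M z%:M z%:M y%:M = 0 :> 'M_(h + h) -> [/\ x = 0, y = 0 & z = 0].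
Proof.
case: h => // h _ /eqP; rewrite block_mx_eq0.
case/and4P=> [/eqP x0 /eqP z0 _ /eqP y0].
by split; [move: x0|move: y0|move: z0];
  move/matrixP/(_ ord0 ord0); rewrite !mxE.
Qed.

End Independence.

(** * Laurent polynomials and the construction of degenerations *)

Section Laurent.
Variable K : numFieldType.
Local Notation frac := {fraction {poly K}}.
Local Notation laurent := (@is_laurent K).

Lemma tofracX_neq0 d : tofrac ('X^d : {poly K}) != 0.
Proof. by rewrite tofrac_eq0 -size_poly_gt0 size_polyXn. Qed.

Lemma laurent_tofrac p : laurent (tofrac p).
Proof. by exists p, 0%N; rewrite expr0 tofrac1 divr1. Qed.

Lemma laurent0 : laurent 0.
Proof. by rewrite -tofrac0; exact: laurent_tofrac. Qed.

Lemma laurent1 : laurent 1.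
Proof. by rewrite -tofrac1; exact: laurent_tofrac. Qed.

Lemma laurentD f g : laurent f -> laurent g -> laurent (f + g).
Proof.
move=> [p [d ->]] [q [e ->]]; exists (p * 'X^e + q * 'X^d), (d + e)%N.
rewrite exprD tofracD !tofracM.
by apply: addf_div; exact: tofracX_neq0.
Qed.

Lemma laurentM f g : laurent f -> laurent g -> laurent (f * g).
Proof.
move=> [p [d ->]] [q [e ->]]; exists (p * q), (d + e)%N.
by rewrite exprD !tofracM mulf_div.
Qed.

Lemma laurent_invX : laurent (tofrac 'X)^-1.
Proof. by exists 1, 1%N; rewrite tofrac1 expr1 div1r. Qed.

Definition laurent_mx m n (A : 'M[frac]_(m, n)) := forall i j, laurent (A i j).

Lemma laurent_mulmx m n p (A : 'M[frac]_(m, n)) (B : 'M[frac]_(n, p)) :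
  laurent_mx A -> laurent_mx B -> laurent_mx (A *m B).
Proof.
move=> lA lB i j; rewrite mxE.
apply: big_ind; [exact: laurent0 | exact: laurentD |].
by move=> k _; apply: laurentM; [exact: lA | exact: lB].
Qed.

Lemma laurent_block m1 m2 n1 n2 (A : 'M[frac]_(m1, n1)) B C
    (D : 'M[frac]_(m2, n2)) :
  laurent_mx A -> laurent_mx B -> laurent_mx C -> laurent_mx D ->
  laurent_mx (block_mx A B C D).
Proof.
move=> lA lB lC lD i j.
case: (split_ordP i) => {}i ->; case: (split_ordP j) => {}j ->.
- by rewrite block_mxEul; exact: lA.
- by rewrite block_mxEur; exact: lB.
- by rewrite block_mxEdl; exact: lC.
- by rewrite block_mxEdr; exact: lD.
Qed.

Lemma laurent_mx0 m n : laurent_mx (0 : 'M_(m, n)).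
Proof. by move=> i j; rewrite mxE; exact: laurent0. Qed.

Lemma laurent_mx1 n : laurent_mx (1%:M : 'M_n).
Proof.
by move=> i j; rewrite mxE; case: (i == j); [exact: laurent1 | exact: laurent0].
Qed.

Lemma laurent_anti n : laurent_mx (anti frac n).
Proof.
by move=> i j; rewrite mxE; case: (j == _); [exact: laurent1 | exact: laurent0].
Qed.

Lemma laurent_torus l s a b :
  laurent a -> laurent b -> laurent_mx (@torus frac l s a b).
Proof.
move=> la lb i j; rewrite mxE mxE; case: (i == j); last by exact: laurent0.
by case: (s i) => //; case: (s _) => //; exact: laurent1.
Qed.

Lemma GL_laurent_intro n (A B : 'M[frac]_n) :
  laurent_mx A -> laurent_mx B -> A *m B = 1%:M -> GL_laurent A.
Proof.
move=> lA lB AB; have [uA _] := mulmx1_unit AB.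
have BE : invmx A = B by rewrite -[LHS]mulmx1 -AB mulKmx.
by split=> //; rewrite BE.
Qed.

Definition free3 n (M : K -> K -> K -> 'M[K]_n) := forall x y z,
  M x y z = 0 -> [/\ x = 0, y = 0 & z = 0].

Lemma basis_net_of n (M : K -> K -> K -> 'M[K]_n) : linear3 M -> free3 M ->
  basis_of (net_of M) [tuple M 1 0 0; M 0 1 0; M 0 0 1].
Proof.
move=> linM freeM; apply/andP; split; first by [].
apply/freeP => c; rewrite !big_ord_recl big_ord0 addr0 addrA /= -linM.
move=> /freeM[c0 c1 c2] [[|[|[|//]]] lt3].
- by rewrite -c0; congr c; apply: val_inj.
- by rewrite -c1; congr c; apply: val_inj.
- by rewrite -c2; congr c; apply: val_inj.
Qed.

(** The shape of both constructions: P fixes the limits of the first two basis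
    vectors, and the third one is rescaled by a unit q. *)
Lemma degenerates_intro n (M M' : K -> K -> K -> 'M[K]_n) (P P' : 'M[frac]_n)
    (q q' : frac) (Z : 'M[{poly K}]_n) :
  linear3 M -> free3 M -> linear3 M' -> free3 M' ->
  laurent_mx P -> laurent_mx P' -> P *m P' = 1%:M ->
  laurent q -> laurent q' -> q * q' = 1 ->
  P *m map_mx (@frac_const K) (M 1 0 0) *m P^T = map_mx (@frac_const K) (M' 1 0 0) ->
  P *m map_mx (@frac_const K) (M 0 1 0) *m P^T = map_mx (@frac_const K) (M' 0 1 0) ->
  q *: (P *m map_mx (@frac_const K) (M 0 0 1) *m P^T) = map_mx (@tofrac _) Z ->
  map_mx (horner_eval 0) Z = M' 0 0 1 ->
  degenerates (net_of M) (net_of M').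
Proof.
move=> linM freeM linM' freeM' lP lP' PP' lq lq' qq' PM1 PM2 PM3 Z0.
(* The diagonal matrix with entries 1, 1, r: the default value of nth provides
   the last one. *)
pose Q r : 'M[frac]_3 := diag_mx (\row_j nth r [:: 1; 1] j).
have lQ r : laurent r -> laurent_mx (Q r).
  move=> lr i j; rewrite mxE mxE; case: (i == j); last exact: laurent0.
  by case: i => [[|[|[|//]]] lt3]; [exact: laurent1|exact: laurent1|exact: lr].
have QQ : Q q *m Q q' = 1%:M.
  rewrite mulmx_diag -diag_const_mx; congr diag_mx; apply/rowP => j; rewrite !mxE.
  by case: j => [[|[|[|//]]] lt3]; [exact: mulr1|exact: mulr1|exact: qq'].
pose C (A : 'M[K]_n) : 'M[{poly K}]_n := map_mx polyC A.
pose Y (j : 'I_3) := nth Z [:: C (M' 1 0 0); C (M' 0 1 0)] j.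
exists 3%N, [tuple M 1 0 0; M 0 1 0; M 0 0 1], [tuple M' 1 0 0; M' 0 1 0; M' 0 0 1].
exists P, (Q q), Y; split.
- exact: basis_net_of.
- exact: basis_net_of.
- exact: GL_laurent_intro PP'.
- exact: GL_laurent_intro (lQ q lq) (lQ q' lq') QQ.
move=> j.
have mapC A : map_mx (@tofrac _) (C A) = map_mx (@frac_const K) A.
  by rewrite -map_mx_comp.
have C0 A a b : (C A a b).[0] = A a b by rewrite mxE hornerC.
split.
  rewrite (bigD1 j) //= big1 ?addr0; last first.
    by move=> i /negPf ij; rewrite mxE ij mulr0n scale0r.
  rewrite !mxE eqxx mulr1n.
  case: j => [[|[|[|//]]] lt3].
  - by rewrite scale1r /Y /= mapC -PM1 (tnth_nth 0).
  - by rewrite scale1r /Y /= mapC -PM2 (tnth_nth 0).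
  - by rewrite /Y /= -PM3 (tnth_nth 0).
move=> a b.
suff <- : (Y j a b).[0] = tnth [tuple M' 1 0 0; M' 0 1 0; M' 0 0 1] j a b.
  exact: horner_cvg0.
rewrite (tnth_nth 0); case: j => [[|[|[|//]]] lt3]; rewrite /Y /= ?C0 //.
by rewrite -Z0 mxE.
Qed.

End Laurent.

(** * The two families of degenerations *)

Section Constructions.
Variable K : numFieldType.
Local Notation frac := {fraction {poly K}}.

Let fc : {rmorphism K -> frac} := @tofrac {poly K} \o @polyC K.
Let t : frac := tofrac 'X.

Let mul_tV : t * t^-1 = 1.
Proof. by apply: mulfV; rewrite tofrac_eq0 polyX_eq0. Qed.

Lemma degenerates_B2_B2 n k l1 l2 : B2_params n k l1 l2 -> (1 < k)%N ->
  degenerates (netB2 K n k l1 l2) (netB2 K n k.-1 l1 l2).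
Proof.
case=> l2_ge2 _ kl; rewrite -addnn addnC => nE k_gt1; case: n / nE.
have [k_l k'_l] : (0 < k <= l2)%N /\ (0 < k.-1 <= l2)%N by lia.
have formE (R : comNzRingType) j x y z : B2_form (l2 + l2 + l1) j l1 l2 x y z
  = block_mx (B2_core j l2 x y z) 0 0 y%:M :> 'M[R]__ by exact: conform_mx_id.
have free j : (0 < j <= l2)%N -> free3 (B2_form (R := K) (l2 + l2 + l1) j l1 l2).
  move=> j_l x y z; rewrite formE => /eqP.
  by rewrite block_mx_eq0 => /and4P[/eqP /(B2_core_eq0 j_l)].
have mapE j x y z : map_mx (@frac_const K) (B2_form (l2 + l2 + l1) j l1 l2 x y z) =
    block_mx (B2_core j l2 (fc x) (fc y) (fc z)) 0 0 (fc y)%:M.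
  by rewrite -formE; exact: (map_B2_form fc).
pose s (i : 'I_l2) := (i == k.-1 :> nat).
have s_rev i : s i -> ~~ s (rev_ord i) by rewrite /s /=; have := ltn_ord i; lia.
pose T := torus s t t^-1.
have TJT : T *m anti _ _ *m T = anti _ _ by exact: torus_anti.
have lT : laurent_mx T.
  by apply: laurent_torus; [exact: laurent_tofrac | exact: laurent_invX].
pose P : 'M[frac]_(l2 + l2 + l1) := block_mx (block_mx T 0 0 1%:M) 0 0 1%:M.
pose P' : 'M[frac]_(l2 + l2 + l1) :=
  block_mx (block_mx (anti _ _ *m T *m anti _ _) 0 0 1%:M) 0 0 1%:M.
pose C : 'M[{poly K}]_l2 := \matrix_(i, j)
  ((if s i then 'X else 1) *+ ((i == j :> nat) && (i < k)%N)).
have TD : T *m pid_mx k = map_mx (@tofrac _) C.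
  apply/matrixP=> i j; rewrite mul_diag_mx !mxE.
  have [/andP[_ ik]|_] := boolP ((i == j :> nat) && (i < k)%N); last first.
    by rewrite mulr0 mulr0n tofrac0.
  rewrite mulr1 mulr1n; case: (s i) => //.
  have /negPf-> : ~~ s (rev_ord i) by rewrite /s /=; have := ltn_ord i; lia.
  by rewrite tofrac1.
have DT : pid_mx k *m T = map_mx (@tofrac _) C^T.
  by rewrite -map_trmx -TD trmx_mul tr_pid_mx tr_torus.
have congrP x y z :
    P *m map_mx (@frac_const K) (B2_form (l2 + l2 + l1) k l1 l2 x y z) *m P^T =
    block_mx (block_mx (fc x *: anti _ _) (fc z *: map_mx (@tofrac _) C)
                (fc z *: map_mx (@tofrac _) C^T) (fc y *: anti _ _))
             0 0 (fc y)%:M.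
  rewrite mapE congr_block_diag.
  by rewrite (congr_B2_core _ _ _ _ (tr_torus _ _ _) TJT) TD DT.
apply: (@degenerates_intro K _ (B2_form (l2 + l2 + l1) k l1 l2)
  (B2_form (l2 + l2 + l1) k.-1 l1 l2) P P' 1 1
  (block_mx (block_mx 0 C C^T 0) 0 0 0)).
- exact: B2_form_linear.
- exact: free.
- exact: B2_form_linear.
- exact: free.
- do 2?apply: laurent_block; try solve [exact: laurent_mx0 | exact: laurent_mx1].
  exact: lT.
- do 2?apply: laurent_block; try solve [exact: laurent_mx0 | exact: laurent_mx1].
  apply: laurent_mulmx; last exact: laurent_anti.
  by apply: laurent_mulmx; first exact: laurent_anti.
- by do 2!apply: block_diag_inv; rewrite torus_inv.
- exact: laurent1.
- exact: laurent1.
- exact: mulr1.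
- by rewrite congrP mapE /B2_core !rmorph0 !scale0r.
- by rewrite congrP mapE /B2_core !rmorph0 !scale0r.
- rewrite scale1r congrP !rmorph0 rmorph1 !scale1r !scale0r.
  by rewrite !map_block_mx !map_mx0.
rewrite formE raddf0 !map_block_mx !map_mx0 /B2_core !scale0r !scale1r.
have C0 : map_mx (horner_eval 0) C = pid_mx k.-1.
  apply/matrixP=> i j; rewrite !mxE /horner_eval hornerMn /s.
  have [ij|] /= := eqVneq (i : nat) j; last by rewrite mulr0n.
  case: eqP => ik; first by rewrite hornerX mul0rn ik ltnn.
  by rewrite hornerC; congr (_%:R); congr nat_of_bool; lia.
by rewrite -map_trmx C0 tr_pid_mx.
Qed.

Lemma degenerates_B1_B2 (im : K) n k : im ^+ 2 = - 1 ->
  ~~ odd n -> (1 <= k)%N -> (4 * k <= n)%N ->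
  degenerates (netB1 K n) (netB2 K n k 0 n./2).
Proof.
move=> im2 n_even k_gt0 kn; have [h_gt0 kh] : (0 < n./2)%N /\ (k.*2 <= n./2)%N by lia.
rewrite /netB1 /B1_mx; move: n./2 (even_halfK n_even) h_gt0 kh.
move=> h nE h_gt0 kh {n_even kn}.
rewrite -addnn in nE; case: n / nE.
have k_h : (0 < k <= h)%N by lia.
pose M (R : comNzRingType) (x y z : R) : 'M[R]_(h + h) := block_mx x%:M z%:M z%:M y%:M.
have -> : (fun x y z => conform_mx (0 : 'M[K]_(h + h)) (M K x y z)) = M K.
  by do 3!apply: boolp.funext => ?; exact: conform_mx_id.
have formE (R : comNzRingType) x y z :
    B2_form (h + h) k 0 h x y z = B2_core k h x y z :> 'M[R]__.
  (* Only the empty block of size 0 and the cast along h + h + 0 = h + h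
     differ. *)
  rewrite /B2_form; move: (B2_core _ _ _ _ _) (y%:M) => A B.
  have e : (h + h + 0 = h + h)%N by rewrite addn0.
  rewrite -[RHS](conform_mx_id 0); apply/matrixP=> i j.
  rewrite /conform_mx; case: eqP => [e1|]; last by rewrite e.
  case: eqP => // e2; rewrite !castmxE /=.
  have -> : cast_ord (esym e1) i = lshift 0 i by exact: val_inj.
  have -> : cast_ord (esym e1) j = lshift 0 j by exact: val_inj.
  rewrite block_mxEul; congr (A _ _); exact: val_inj.
pose s (i : 'I_h) := (i < k)%N.
have s_rev i : s i -> ~~ s (rev_ord i) by rewrite /s /=; have := ltn_ord i; lia.
pose T := torus s t^-1 t.
have TJT : T *m anti _ _ *m T = anti _ _ by apply: torus_anti => //; rewrite mulrC.
have lT : laurent_mx T.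
  by apply: laurent_torus; [exact: laurent_invX | exact: laurent_tofrac].
have two : 2%:R != 0 :> K by rewrite pnatr_eq0.
(* The solution of a^2 + b^2 = 0 and 2 a b = 1 with b = im * a. *)
pose a : K := (1 - im) / 2%:R; pose b : K := (1 + im) / 2%:R.
have ab0 : a ^+ 2 + b ^+ 2 = 0.
  have -> : a ^+ 2 + b ^+ 2 = (1 + im ^+ 2) / 2%:R by rewrite /a /b; field.
  by rewrite im2 subrr mul0r.
have ab1 : (a * b) *+ 2 = 1.
  have -> : (a * b) *+ 2 = (1 - im ^+ 2) / 2%:R by rewrite /a /b; field.
  by rewrite im2 opprK divff.
pose S := map_mx fc (sqrt_anti h a b).
have trS : S^T = S by rewrite /S map_trmx tr_sqrt_anti.
have SS : S *m S = anti _ _ by rewrite /S -map_mxM sqrt_antiP // map_anti.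
have lS : laurent_mx S by move=> i j; rewrite mxE; exact: laurent_tofrac.
have lJ : laurent_mx (anti frac h) by exact: laurent_anti.
pose C : 'M[{poly K}]_h := \matrix_(i, j)
  ((if s i then 1 else if s (rev_ord i) then 'X * 'X else 'X) *+ (i == j)).
have tT : t *: T = map_mx (@tofrac _) C.
  apply/matrixP=> i j; rewrite !mxE.
  have [_|_] := eqVneq i j; last by rewrite !mulr0n mulr0 tofrac0.
  rewrite !mulr1n; case: (s i); first by rewrite mul_tV tofrac1.
  by case: (s _); [rewrite tofracM | rewrite mulr1].
pose P : 'M[frac]_(h + h) := block_mx S 0 0 (T *m anti _ _ *m S).
pose P' : 'M[frac]_(h + h) :=
  block_mx (S *m anti _ _) 0 0 (S *m (anti _ _ *m T *m anti _ _)).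
have congrP x y z : P *m map_mx (@frac_const K) (M K x y z) *m P^T =
    block_mx (fc x *: anti _ _) (fc z *: T) (fc z *: T) (fc y *: anti _ _).
  rewrite /M map_block_mx !(map_scalar_mx fc).
  by apply: congr_scalar_block => //; exact: tr_torus.
have mapE x y z : map_mx (@frac_const K) (B2_form (h + h) k 0 h x y z) =
    B2_core k h (fc x) (fc y) (fc z).
  by rewrite -formE; exact: (map_B2_form fc).
apply: (@degenerates_intro K _ (M K) (B2_form (h + h) k 0 h) P P' t t^-1
  (block_mx 0 C C 0)).
- move=> x y z; rewrite /M !scale_block_mx !add_block_mx !scale_scalar_mx.
  by rewrite !mulr1 !mulr0 !raddf0 !(addr0, add0r).
- by move=> x y z; exact: scalar_block_eq0.
- exact: B2_form_linear.
- by move=> x y z; rewrite formE; exact: B2_core_eq0.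
- apply: laurent_block; [exact: lS | exact: laurent_mx0 | exact: laurent_mx0 |].
  by do 2!(apply: laurent_mulmx => //).
- apply: laurent_block; [| exact: laurent_mx0 | exact: laurent_mx0 |].
    exact: laurent_mulmx.
  by do 3!(apply: laurent_mulmx => //).
- exact: scalar_block_inv.
- exact: laurent_tofrac.
- exact: laurent_invX.
- exact: mul_tV.
- by rewrite congrP mapE /B2_core !rmorph0 !scale0r.
- by rewrite congrP mapE /B2_core !rmorph0 !scale0r.
- rewrite congrP !rmorph0 rmorph1 !scale0r scale1r scale_block_mx !scaler0 tT.
  by rewrite map_block_mx !map_mx0.
have C0 : map_mx (horner_eval 0) C = pid_mx k.
  apply/matrixP=> i j; rewrite !mxE /horner_eval hornerMn /s -(inj_eq val_inj) /=.
  have [ij|] /= := eqVneq (i : nat) j; last by rewrite mulr0n.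
  rewrite mulr1n; case: ifP => ik; first by rewrite hornerC.
  by case: ifP => _; rewrite ?hornerM !hornerX ?mulr0.
by rewrite formE map_block_mx !map_mx0 C0 /B2_core !scale0r !scale1r.
Qed.
End Constructions.

Theorem proposition7p2 (R : realType) (n : nat) (hn : (2 <= n)%N) :
  [/\ forall k : nat, ~~ odd n -> (1 <= k)%N -> (4 * k <= n)%N ->
        degenerates (netB1 R[i] n) (netB2 R[i] n k 0 n./2),
      forall k l1 l2 : nat, B2_params n k l1 l2 -> (1 < k)%N ->
        degenerates (netB2 R[i] n k l1 l2) (netB2 R[i] n k.-1 l1 l2) &
      forall L L' : {vspace 'M[R[i]]_n},
        is_net L -> is_net L' -> degenerates L L' ->
        clos_refl_trans _ (@generating_step R[i] n) L L'].
Proof.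
split=> [k n_even k_gt0 kn|k l1 l2 par k_gt1|L L'].
- exact: (@degenerates_B1_B2 _ 'i%C) (sqr_i R) n_even k_gt0 kn.
- exact: degenerates_B2_B2.
- exact: degenerations_among_nets.
Qed.
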